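(* Let $n>1$ be an integer and let $M_{2n}$ be the Möbius ladder on $2n$ vertices. Then \[ \det A(M_{2n})= \begin{cases} -3 & \text{if } n\equiv \pm 2 \pmod{6};\\ -9 & \text{if } n\equiv \pm 1 \pmod{6};\\ 0 & \text{otherwise}. \end{cases} \]
   Context: For a graph $G$, $A(G)$ denotes its adjacency matrix. The Möbius ladder $M_{2n}$ is the graph on vertices $v_1,\dots,v_{2n}$ whose edge set is the union of the edge set of the cycle $v_1v_2\cdots v_{2n}v_1$ and the set $\{v_iv_{n+i}: i=1,\dots,n\}$. *)

(* Defs.v *)
From mathcomp Require Import all_boot all_order all_algebra.

Set Implicit Arguments.
Unset Strict Implicit.
Unset Printing Implicit Defensive.

Import GRing.Theory.
Local Open Scope ring_scope.

Record graph (T : finType) := Graph {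
  edges : {set {set T}};
  edges_card2 : forall e, e \in edges -> #|e| = 2%N
}.

Definition adjacent (T : finType) (G : graph T) (x y : T) : bool :=
  [set x; y] \in edges G.

Definition adjacency_mx (m : nat) (G : graph 'I_m) : 'M[int]_m :=
  \matrix_(i, j) (adjacent G i j)%:R.

(* [ordS] is the successor modulo m, so the edge from the last vertex back to
   the first one is included. *)
Definition cycle_edges (m : nat) : {set {set 'I_m}} :=
  [set [set i; ordS i] | i : 'I_m].

(* The vertex v_k (k = 1, ..., 2n) is the ordinal k - 1 of 'I_(n + n). For
   i : 'I_n, [lshift n i] and [rshift n i] have values i and n + i. *)
Definition rung_edges (n : nat) : {set {set 'I_(n + n)}} :=
  [set [set lshift n i; rshift n i] | i : 'I_n].

Lemma mobius_edges_card2 (n : nat) (e : {set 'I_(n + n)}) :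
  e \in cycle_edges (n + n) :|: rung_edges n -> #|e| = 2%N.
Proof.
case/setUP => /imsetP [i _ ->]; rewrite cards2.
- suff -> : i != ordS i by [].
  apply/eqP => /(congr1 val) /= eqi.
  have lti := ltn_ord i.
  have [eqm|neqm] := eqVneq i.+1 (n + n)%N.
    move: eqi; rewrite eqm modnn => i0.
    by move: (congr1 odd eqm); rewrite i0 addnn odd_double.
  have lt1 : (i.+1 < n + n)%N by rewrite ltn_neqAle neqm.
  by move: eqi; rewrite modn_small // => /n_Sn.
- by rewrite eq_lrshift.
Qed.

Definition mobius_ladder (n : nat) : graph 'I_(n + n) :=
  Graph (@mobius_edges_card2 n).

(* Main.v *)
(** The adjacency matrix is circulant: at a (2n)-th root of unity w it has the
    eigenvalue w + w^-1 + w^n, the eigenvectors being the columns of the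
    Vandermonde matrix of these roots. Here w^n is 1 or -1, so w times the
    eigenvalue is w^2 + w + 1 or w^2 - w + 1, which splits over the primitive
    cube roots of unity a and b; the factorisations of X^n - 1 and X^n + 1 then
    give the determinant
    - (a^n - 1) (b^n - 1) ((- a)^n + 1) ((- b)^n + 1),
    which depends only on n modulo 6. *)

Require Import Defs.
From mathcomp Require Import all_boot all_order all_algebra.
From mathcomp Require Import all_field zify ring.
Import GRing.Theory Num.Theory.
Local Open Scope ring_scope.

(** This is addition of [n] modulo [n + n], encoded as an exchange of the two halves to match the
    shape of [rung_edges]. *)
Definition antipode {n : nat} (i : 'I_(n + n)) : 'I_(n + n) :=
  match split i with inl j => rshift n j | inr j => lshift n j end.

Lemma set2_eq {T : finType} (a b c d : T) :
  [set a; b] = [set c; d] -> (a = c /\ b = d) \/ (a = d /\ b = c).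
Proof.
move=> e.
have : a \in [set c; d] by rewrite -e set21.
have : b \in [set c; d] by rewrite -e set22.
have : c \in [set a; b] by rewrite e set21.
have : d \in [set a; b] by rewrite e set22.
rewrite !inE.
by do 4!(case/orP => /eqP ?); subst; auto.
Qed.

Lemma adjacent_mobius (n : nat) (i k : 'I_(n + n)) :
  adjacent (mobius_ladder n) i k = (k \in [:: ordS i; ord_pred i; antipode i]).
Proof.
rewrite /adjacent /= !inE; apply/orP/or3P.
  case=> /imsetP [u _ /(set2_eq _ _ _ _) [] [-> ->]].
  - by apply: Or31.
  - by apply: Or32; rewrite ordSK.
  - by apply: Or33; rewrite /antipode -[lshift n u]/(unsplit (inl u)) unsplitK.
  - by apply: Or33; rewrite /antipode -[rshift n u]/(unsplit (inr u)) unsplitK.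
case=> /eqP ->.
- by left; apply: imset_f.
- by left; apply/imsetP; exists (ord_pred i); rewrite // ord_predK setUC.
- right; rewrite /antipode; case: (split_ordP i) => j ->; apply/imsetP; exists j => //.
  by rewrite setUC.
Qed.

(** For [n = 1] the three neighbours coincide. Their distinctness lets a 0/1 row of the adjacency
    matrix act as a sum of three separate terms. *)
Lemma neighbours_uniq {n : nat} (i : 'I_(n + n)) : (1 < n)%N ->
  uniq [:: ordS i; ord_pred i; antipode i].
Proof.
move=> n1; have n0 : (0 < n + n)%N by lia.
have lti := ltn_ord i.
(* Spelling out the wrap-around of [ordS] and [ord_pred] leaves only linear arithmetic. *)
have modS : (i.+1 %% (n + n))%N = if i.+1 == (n + n)%N then 0%N else i.+1.
  by case: eqP => [->|?]; [rewrite modnn | rewrite modn_small //; lia].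
have modP : ((i + (n + n)).-1 %% (n + n))%N
            = if i == 0 :> nat then (n + n).-1 else i.-1.
  case: eqP => [->|?]; first by rewrite modn_small // add0n; lia.
  have -> : (i + (n + n)).-1 = (i.-1 + (n + n))%N by lia.
  by rewrite modnDr modn_small //; lia.
rewrite /= !inE -!val_eqE /= modS modP /antipode.
case: split_ordP => j /(congr1 val) /= vi; have ltj := ltn_ord j;
  clear modS modP; case: (i.+1 =P _) => ?; case: (_ =P 0%N) => ?; lia.
Qed.

Lemma sum_adjacent (R : pzRingType) (n : nat) (i : 'I_(n + n)) (f : 'I_(n + n) -> R) :
  (1 < n)%N ->
  \sum_k (adjacent (mobius_ladder n) i k)%:R * f k
  = f (ordS i) + f (ord_pred i) + f (antipode i).
Proof.
move=> n1.
transitivity (\sum_(k <- [:: ordS i; ord_pred i; antipode i]) f k).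
  rewrite (big_uniq _ (neighbours_uniq i n1)) [RHS]big_mkcond /=.
  apply: eq_bigr => k _; rewrite adjacent_mobius.
  by case: ifP => _; rewrite ?mul1r ?mul0r.
by rewrite !big_cons big_nil addr0 addrA.
Qed.

Lemma expr_antipode (R : pzRingType) (n : nat) (w : R) (i : 'I_(n + n)) :
  w ^+ (n + n) = 1 -> w ^+ antipode i = w ^+ n * w ^+ i.
Proof.
move=> w1; rewrite /antipode; case: split_ordP => j -> /=.
  by rewrite exprD.
by rewrite exprD mulrA -exprD w1 mul1r.
Qed.

(* The product of all [z ^+ j] on the left clears the inverses in the eigenvalues. *)
Lemma det_mobius_mul_prod (F : fieldType) (n : nat) (z : F) :
  (1 < n)%N -> (n + n).-primitive_root z ->
  (\det (adjacency_mx (mobius_ladder n)))%:~R * \prod_(j < n + n) z ^+ j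
  = \prod_(j < n + n) (z ^+ j * z ^+ j + 1 + (z ^+ j) ^+ n * z ^+ j).
Proof.
move=> n1 pz.
set A := map_mx intr (adjacency_mx (mobius_ladder n)) : 'M[F]_(n + n).
pose V := Vandermonde (n + n) (\row_(j < n + n) z ^+ j).
pose D := \row_(j < n + n) z ^+ j.
pose L := \row_(j < n + n) (z ^+ j * z ^+ j + 1 + (z ^+ j) ^+ n * z ^+ j).
have AV : A *m V *m diag_mx D = V *m diag_mx L.
  apply/matrixP=> i j; rewrite !mul_mx_diag !mxE.
  set w := z ^+ j.
  have w1 : w ^+ (n + n) = 1 by rewrite /w exprAC (prim_expr_order pz) expr1n.
  have wS (k : 'I_(n + n)) : w ^+ ordS k = w * w ^+ k.
    by rewrite /= expr_mod // exprS.
  transitivity ((\sum_k (adjacent (mobius_ladder n) i k)%:R * w ^+ k) * w).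
    by congr (_ * _); apply: eq_bigr => k _; rewrite !mxE rmorph_nat.
  (* Passing to the exponent [ord_pred i] makes the eigenvalue equation a polynomial identity in
     [w], free of inverses. *)
  have wP : w ^+ i = w * w ^+ ord_pred i by rewrite -wS ord_predK.
  by rewrite sum_adjacent // wS expr_antipode // wP; ring.
have detV : \det V != 0.
  rewrite det_Vandermonde; apply/prodf_neq0 => i _; apply/prodf_neq0 => j ltij.
  rewrite !mxE subr_eq0 (eq_prim_root_expr pz) !modn_small //.
  by rewrite gtn_eqF.
apply: (mulfI detV); have := congr1 determinant AV.
rewrite !det_mulmx !det_diag det_map_mx mulrC !mulrA.
under [\prod_i D _ _]eq_bigr do rewrite mxE.
under [\prod_i L _ _]eq_bigr do rewrite mxE.
by move=> <-; ring.
Qed.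

Lemma prod_sub_expr {F : fieldType} {n : nat} {z} (x : F) :
  n.-primitive_root z -> \prod_(0 <= i < n) (x - z ^+ i) = x ^+ n - 1.
Proof.
move=> pz; have := congr1 (horner^~ x) (factor_Xn_sub_1 pz).
rewrite horner_prod !hornerE => <-.
by apply: eq_bigr => i _; rewrite !hornerE.
Qed.

Lemma prod_nat_parity (R : comPzRingType) (n : nat) (f : nat -> R) :
  \prod_(0 <= j < n + n) f j
  = (\prod_(0 <= k < n) f k.*2) * \prod_(0 <= k < n) f k.*2.+1.
Proof.
elim: n => [|n IH]; first by rewrite !big_nil mulr1.
by rewrite addnS addSn !big_nat_recr //= IH addnn; ring.
Qed.

(* With [w = z ^+ j], even [j] contribute [w^2 + w + 1 = (a - w) * (b - w)] and
   odd [j] contribute [w^2 - w + 1 = (- a - w) * (- b - w)]. *)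
Lemma det_mobius_cube_roots (F : fieldType) (n : nat) (z a b : F) :
  (1 < n)%N -> (n + n).-primitive_root z -> a + b = - 1 -> a * b = 1 ->
  (\det (adjacency_mx (mobius_ladder n)))%:~R
  = - ((a ^+ n - 1) * (b ^+ n - 1) * ((- a) ^+ n + 1) * ((- b) ^+ n + 1)).
Proof.
move=> n1 pz sab pab.
have n2 : (0 < n + n)%N by lia.
have z0 : z != 0.
  apply/eqP => z0; have := prim_expr_order pz.
  by rewrite z0 expr0n; case: eqP => [|_ /esym/eqP]; [lia | rewrite oner_eq0].
(* [z ^+ n] squares to 1, and it is not 1 because the order [n + n] of [z] exceeds [n]. *)
have zn : z ^+ n = - 1.
  have : (z ^+ n) ^+ 2 == 1 by rewrite -exprM muln2 -addnn (prim_expr_order pz).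
  rewrite sqrf_eq1 => /orP[|/eqP //].
  by rewrite -(prim_order_dvd pz) => /dvdn_leq; lia.
have zkn k : (z ^+ k) ^+ n = (- 1) ^+ k by rewrite exprAC zn.
have pz2 : n.-primitive_root (z ^+ 2).
  have := exp_prim_root pz 2.
  by rewrite addnn -muln2 gcdnMl mulnK.
have prod_even (x : F) : \prod_(0 <= k < n) (x - z ^+ k.*2) = x ^+ n - 1.
  rewrite -(prod_sub_expr x pz2); apply: eq_bigr => k _.
  by rewrite -exprM mul2n.
have prod_odd (x : F) : \prod_(0 <= k < n) (x - z ^+ k.*2.+1) = x ^+ n + 1.
  (* Odd powers are [z] times even ones; with [z] pulled out of each factor, [z ^+ n = - 1] turns
     [(x / z) ^+ n - 1] into [x ^+ n + 1]. *)
  transitivity (\prod_(0 <= k < n) (z * (x / z - z ^+ k.*2))).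
    by apply: eq_bigr => k _; rewrite exprS; field.
  rewrite big_split /= prod_even prodr_const_nat subn0 expr_div_n zn.
  by rewrite invrN1; ring.
have prodz : \prod_(j < n + n) z ^+ j = - 1.
  (* The product is read off from [X ^+ (n + n) - 1] at 0; the signs cancel since the number of
     factors is even. *)
  have := prod_sub_expr 0 pz; rewrite expr0n gtn_eqF // sub0r => <-.
  rewrite big_mkord; under [RHS]eq_bigr do rewrite sub0r.
  by rewrite prodrN card_ord addnn -muln2 mulnC exprM sqrrN expr1n expr1n mul1r.
(* The determinant is written as [- (det * - 1)], and this [- 1] is then the product of the
   [z ^+ j]. *)
rewrite -[LHS]opprK -[X in - X = _]mulrN1 -[X in - (_ * X) = _]prodz det_mobius_mul_prod //.
congr (- _).
rewrite -(big_mkord xpredT (fun j => z ^+ j * z ^+ j + 1 + (z ^+ j) ^+ n * z ^+ j)).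
rewrite prod_nat_parity -(prod_even a) -(prod_even b) -(prod_odd (- a)).
rewrite -(prod_odd (- b)) -mulrA.
congr (_ * _); rewrite -big_split /=; apply: eq_bigr => k _.
  rewrite zkn -signr_odd odd_double expr0; set w := z ^+ _.
  transitivity (w * w + a * b - (a + b) * w); last by ring.
  by rewrite sab pab; ring.
rewrite zkn -signr_odd /= odd_double expr1; set w := z ^+ _.
transitivity (w * w + a * b + (a + b) * w); last by ring.
by rewrite sab pab; ring.
Qed.

Theorem theorem2 (n : nat) (hn : (1 < n)%N) :
  \det (adjacency_mx (mobius_ladder n)) =
    if (n%:Z == 2 %[mod 6])%Z || (n%:Z == - 2 %[mod 6])%Z then - 3
    else if (n%:Z == 1 %[mod 6])%Z || (n%:Z == - 1 %[mod 6])%Z then - 9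
    else 0.
Proof.
have n2 : (0 < n + n)%N by lia.
have [z pz] := C_prim_root_exists n2.
have [a pa] := @C_prim_root_exists 3 isT.
have a3 : a ^+ 3 = 1 := prim_expr_order pa.
(* The other primitive cube root of unity, written so that the sum is immediate. *)
pose b : algC := - 1 - a.
have sab : a + b = - 1 by rewrite /b; ring.
have pab : a * b = 1.
  have a1 : a - 1 != 0.
    by rewrite subr_eq0 -[a]expr1 -(prim_order_dvd pa).
  (* Multiplying by [a - 1] reduces the quadratic relation for [a] to [a ^+ 3 = 1]. *)
  apply: (mulfI a1); rewrite /b.
  have -> : (a - 1) * (a * (- 1 - a)) = a - a ^+ 3 by ring.
  by rewrite a3 mulr1.
have b3 : b ^+ 3 = 1.
  by rewrite -[LHS]mul1r -a3 -exprMn pab expr1n.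
apply: (@intr_inj algC); rewrite (@det_mobius_cube_roots _ n z a b) //.
(* The bases [a], [b], [- a], [- b] are all sixth roots of unity, so only [n %% 6] matters. *)
have red c : c ^+ 3 = 1 -> forall d : algC, (d = c \/ d = - c) ->
    d ^+ n = d ^+ (n %% 6).
  move=> c3 d dc; rewrite expr_mod //.
  have -> : d ^+ 6 = (c ^+ 3) ^+ 2 by case: dc => ->; ring.
  by rewrite c3 expr1n.
rewrite (red a) ?(red b b3 b) ?(red a a3 (- a)) ?(red b b3 (- b)); auto.
have modk k : (n%:Z == k %[mod 6])%Z = ((n %% 6)%N%:Z == k %[mod 6])%Z.
  by rewrite -modz_nat modz_mod.
rewrite (modk 2) (modk (- 2)) (modk 1) (modk (- 1)).
(* Reducing by this relation brings every expression to the form [x + y * a], which settles each of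
   the six residues. *)
have sqa : a ^+ 2 = - 1 - a by rewrite -[in RHS]pab /b; ring.
have : (n %% 6 < 6)%N by rewrite ltn_mod.
case: (n %% 6)%N => [|[|[|[|[|[|//]]]]]] _ /=; rewrite /b.
all: by ring: sqa.
Qed.
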